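(* If $G$ is a graph on $n \geq 2$ vertices, then (i) $2 \leq \alpha_{ir}(G) + \alpha_{ir}(\bar{G}) \leq n$, (ii) $1 \leq \alpha_{ir}(G)\, \alpha_{ir}(\bar{G}) \leq \lfloor \frac{n}{2} \rfloor \lfloor \frac{n+1}{2} \rfloor$. Moreover, the bounds are sharp: for each of the lower and upper bounds in (i) and (ii), there exist graphs on at least $2$ vertices for which equality holds.
   Context: All graphs are finite, simple and undirected. $\bar{G}$ denotes the complement of $G$. An irregular independent set of $G$ is an independent set $A$ of $G$ such that any two distinct vertices in $A$ have different degrees in $G$; the irregular independence number $\alpha_{ir}(G)$ is the size of a largest irregular independent set of $G$. *)

(* Defs.v *)
From mathcomp Require Import all_boot.

Set Implicit Arguments.
Unset Strict Implicit.
Unset Printing Implicit Defensive.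

Record sgraph := SGraph {
  vertex :> finType;
  adj : rel vertex;
  adj_sym : symmetric adj;
  adj_irrefl : irreflexive adj }.

Section Complement.
Variable G : sgraph.

Definition compl_adj : rel G := fun x y => (x != y) && ~~ adj x y.

Lemma compl_adj_sym : symmetric compl_adj.
Proof. by move=> x y; rewrite /compl_adj eq_sym adj_sym. Qed.

Lemma compl_adj_irrefl : irreflexive compl_adj.
Proof. by move=> x; rewrite /compl_adj eqxx. Qed.

Definition complement : sgraph := SGraph compl_adj_sym compl_adj_irrefl.

End Complement.

Section IrregularIndependence.
Variable G : sgraph.

Definition degree (x : G) : nat := #|[set y : G | adj x y]|.

Definition independent (A : {set G}) : bool :=
  [forall x in A, forall y in A, ~~ adj x y].

Definition irregular_independent (A : {set G}) : bool :=
  independent A &&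
  [forall x in A, forall y in A, (x != y) ==> (degree x != degree y)].

(* The empty set qualifies, so this is the maximum over a nonempty family. *)
Definition alpha_ir : nat :=
  \max_(A : {set G} | irregular_independent A) #|A|.

End IrregularIndependence.

(* Main.v *)
(** An independent set [A] and a clique [B] share at most one vertex, so
    [#|A| + #|B| <= n + 1].  If equality held with [A] and [B] irregular, then
    [A] and [B] would cover the graph and share a vertex [v]; every degree in
    [A] would be at most [deg v = #|B| - 1] and every degree in [B] at least
    that, so all [n >= 2] degrees would be distinct.  This is impossible: an
    isolated vertex and a dominating one would coexist.  For sharpness, on two
    vertices the lower and upper bounds coincide. *)
Require Import Defs.
From mathcomp Require Import all_boot zify.

Set Implicit Arguments.
Unset Strict Implicit.
Unset Printing Implicit Defensive.

Section Graph.
Variable G : sgraph.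
Implicit Types (x y : G) (A B : {set G}).

Lemma irregular_independentP A :
  reflect ({in A &, forall x y, ~~ adj x y} /\ {in A &, injective (@degree G)})
          (irregular_independent A).
Proof.
apply: (iffP andP) => [[/forall_inP indA /forall_inP irrA] | [indA irrA]].
  split=> x y Ax Ay; first by move/forall_inP: (indA x Ax); apply.
  move=> eq_deg; apply/eqP; apply: contraT => neq_xy.
  move/forall_inP: (irrA x Ax) => /(_ y Ay) /implyP /(_ neq_xy).
  by rewrite eq_deg eqxx.
split; apply/forall_inP=> x Ax; apply/forall_inP=> y Ay; first exact: indA.
by apply/implyP; apply: contraNneq => /(irrA _ _ Ax Ay) ->.
Qed.

Lemma degree_lt_card x : degree x < #|G|.
Proof.
rewrite -cardsT; apply/proper_card/properP; split; first exact: subsetT.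
by exists x; rewrite ?inE ?adj_irrefl.
Qed.

(** Every vertex other than [x] is a neighbour of [x] in exactly one of the two graphs. *)
Lemma degree_complement x : degree x + @degree (complement G) x = #|G|.-1.
Proof.
rewrite -cardsT (cardsD1 x [set: G]) inE add1n /= /degree.
rewrite -(cardsID [set y | adj x y] ([set: G] :\ x)); congr (_ + _).
  apply: eq_card => y; rewrite !inE andbT.
  by case: eqP => // ->; rewrite adj_irrefl.
apply: eq_card => y; rewrite !inE /= /compl_adj andbT eq_sym.
exact: andbC.
Qed.

Lemma degree_not_injective : 1 < #|G| -> ~ injective (@degree G).
Proof.
move=> n_gt1 inj_deg.
(* An injection into a finite type of the same size is onto, so both 0 and [#|G|.-1] occur as
   degrees. *)
pose f x : 'I_#|G| := Ordinal (degree_lt_card x).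
have inj_f : injective f by move=> x y [] /inj_deg.
have surj k : k < #|G| -> exists x, degree x = k.
  move=> lt_k; have : Ordinal lt_k \in codom f.
    by rewrite inj_card_onto // card_ord.
  by case/codomP => x [->]; exists x.
have [x deg_x] := surj 0 (ltnW n_gt1).
have [|y deg_y] := surj #|G|.-1; first by lia.
have := @degree_complement y; rewrite deg_y => deg_cy.
have neq_yx : y != x by apply: contra_eq_neq deg_y => ->; lia.
(* [x] has no neighbour in [G] and [y] has none in the complement, yet the pair must be adjacent in
   one of the two. *)
have /cards0_eq/setP/(_ y) : degree x = 0 by [].
have /cards0_eq/setP/(_ x) : @degree (complement G) y = 0 by lia.
by rewrite !inE /= /compl_adj neq_yx adj_sym => /negbFE ->.
Qed.

Lemma alpha_ir_witness :
  exists2 A : {set G}, irregular_independent A & #|A| = alpha_ir G.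
Proof.
have irr0 : irregular_independent (set0 : {set G}).
  by apply/irregular_independentP; split=> x y; rewrite inE.
rewrite /alpha_ir (bigmax_eq_arg _ irr0).
by case: arg_maxnP => // A irrA _; exists A.
Qed.

Lemma alpha_ir_gt0 : 0 < #|G| -> 0 < alpha_ir G.
Proof.
case/card_gt0P => x _; rewrite -(cards1 x).
apply: (leq_bigmax_cond (F := fun A : {set G} => #|A|)).
apply/irregular_independentP.
by split=> y z /set1P -> /set1P ->; rewrite ?adj_irrefl.
Qed.

(** Through this, a set that is irregular in the complement also has distinct degrees in [G]. *)
Lemma eq_degree_complement x y :
  degree x = degree y -> @degree (complement G) x = @degree (complement G) y.
Proof.
by move=> eq_deg; have := degree_complement x; have := degree_complement y; lia.
Qed.

Lemma clique_adj B :
  {in B &, forall x y, ~~ @adj (complement G) x y} ->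
  {in B &, forall x y, x != y -> adj x y}.
Proof.
move=> cliqB x y Bx By neq_xy; move: (cliqB x y Bx By).
by rewrite /= /compl_adj neq_xy negbK.
Qed.

End Graph.

Lemma irregular_independent_clique_le (G : sgraph) (A B : {set G}) :
  1 < #|G| -> irregular_independent A ->
  @irregular_independent (complement G) B -> #|A| + #|B| <= #|G|.
Proof.
move=> n_gt1 /irregular_independentP[indA irrA].
case/irregular_independentP => /(@clique_adj G B) cliqB irrB.
rewrite leqNgt; apply/negP => gt_n.
have cap_le1 : #|A :&: B| <= 1.
  apply/card_le1_eqP => x y /setIP[Ax Bx] /setIP[Ay By]; apply/eqP.
  by apply: contraNT (indA y x Ay Ax); apply: cliqB.
have cardAB := cardsUI A B; have leU : #|A :|: B| <= #|G| := max_card _.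
(* More than [#|G|] memberships with at most one overlap leave no vertex uncovered; the overlap is
   then nonempty too. *)
have coverAB x : x \in A :|: B.
  have /eqP-> : A :|: B == setT; last by rewrite inE.
  by rewrite eqEcard subsetT cardsT -ltnS (leq_trans gt_n) //=; lia.
have /card_gt0P[v /setIP[Av Bv]] : 0 < #|A :&: B| by lia.
(* Neighbours of [x] avoid the independent set [A], so they lie in [B] and differ from [v], which is
   in [A]. *)
have degA x : x \in A -> degree x <= #|B|.-1.
  move=> Ax; rewrite (cardsD1 v B) Bv; apply/subset_leq_card/subsetP => y.
  rewrite !inE => xy; have nAy : y \notin A.
    by apply: contraL xy => Ay; apply: indA.
  have := coverAB y; rewrite inE (negPf nAy) /= => ->.
  by rewrite andbT; apply: contraNneq nAy => ->.
have degB y : y \in B -> #|B|.-1 <= degree y.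
  move=> By; rewrite (cardsD1 y B) By; apply/subset_leq_card/subsetP => z.
  by rewrite !inE eq_sym => /andP[neq_yz Bz]; apply: cliqB.
(* A common degree must be [#|B|.-1], which is also the degree of [v]; irregularity of [A] gives
   [x = v], and that of [B] gives [v = y]. *)
have degAB x y : x \in A -> y \in B -> degree x = degree y -> x = y.
  move=> Ax By eq_xy.
  have [[deg_x deg_y] [le_v ge_v]] :=
    ((degA x Ax, degB y By), (degA v Av, degB v Bv)).
  have -> : x = v by apply: irrA => //; lia.
  by apply: (irrB v y) => //; apply: eq_degree_complement; lia.
apply: (degree_not_injective n_gt1) => x y eq_xy.
have /setUP[Ax|Bx] := coverAB x; have /setUP[Ay|By] := coverAB y.
- exact: irrA.
- exact: degAB.
- by apply/esym/degAB.
- by apply: (irrB x y) => //; apply: eq_degree_complement.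
Qed.

Lemma alpha_ir_add_le (G : sgraph) :
  1 < #|G| -> alpha_ir G + alpha_ir (complement G) <= #|G|.
Proof.
move=> n_gt1; have [A irrA <-] := alpha_ir_witness G.
have [B irrB <-] := alpha_ir_witness (complement G).
exact: irregular_independent_clique_le.
Qed.

(** With [h = n %/ 2], [h (n - h) - a (n - a) = (h - a) (n - h - a)]. Over the integers, both
    factors are nonnegative if [a <= h] and nonpositive otherwise. *)
Lemma mul_le_half_mul a b n :
  a + b <= n -> a * b <= (n %/ 2) * ((n + 1) %/ 2).
Proof.
move=> le_n; have := divn_eq n 2; have := ltn_pmod n (isT : 0 < 2).
have -> : (n + 1) %/ 2 = n - n %/ 2 by lia.
case: (leqP a (n %/ 2)) => ?; nia.
Qed.

Lemma alpha_ir_bounds (n : nat) (G : sgraph) : #|G| = n -> 2 <= n ->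
  (2 <= alpha_ir G + alpha_ir (complement G) <= n) /\
  (1 <= alpha_ir G * alpha_ir (complement G) <= (n %/ 2) * ((n + 1) %/ 2)).
Proof.
move=> <- n_gt1; have le_n := alpha_ir_add_le n_gt1.
have a_gt0 := alpha_ir_gt0 (ltnW n_gt1).
have b_gt0 := @alpha_ir_gt0 (complement G) (ltnW n_gt1).
by rewrite le_n mul_le_half_mul // muln_gt0 a_gt0 b_gt0; split=> //; lia.
Qed.

Definition edgeless2 : sgraph :=
  @SGraph bool (fun _ _ => false) (fun _ _ => erefl) (fun _ => erefl).

Theorem theorem6p1 :
  (forall (n : nat) (G : sgraph), #|G| = n -> 2 <= n ->
     (2 <= alpha_ir G + alpha_ir (complement G) <= n) /\
     (1 <= alpha_ir G * alpha_ir (complement G) <= (n %/ 2) * ((n + 1) %/ 2)))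
  /\ (exists G : sgraph,
        2 <= #|G| /\ alpha_ir G + alpha_ir (complement G) = 2)
  /\ (exists G : sgraph,
        2 <= #|G| /\ alpha_ir G + alpha_ir (complement G) = #|G|)
  /\ (exists G : sgraph,
        2 <= #|G| /\ alpha_ir G * alpha_ir (complement G) = 1)
  /\ (exists G : sgraph,
        2 <= #|G| /\
        alpha_ir G * alpha_ir (complement G) =
          (#|G| %/ 2) * ((#|G| + 1) %/ 2)).
Proof.
have card2 : #|edgeless2| = 2 := card_bool.
(* For [n = 2] the product bound is [(2 %/ 2) * (3 %/ 2) = 1], so the general bounds fix both values
   without computing [alpha_ir]. *)
have [sum2 prod1] := alpha_ir_bounds card2 (leqnn 2).
have {}sum2 : alpha_ir edgeless2 + alpha_ir (complement edgeless2) = 2.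
  by apply/eqP; rewrite eqn_leq andbC.
have {}prod1 : alpha_ir edgeless2 * alpha_ir (complement edgeless2) = 1.
  by apply/eqP; rewrite eqn_leq andbC.
by split; [exact: alpha_ir_bounds | do !split; exists edgeless2; rewrite card2].
Qed.
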